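(* Let $\sigma$ and $\tau$ be two signed permutation matrices which are NE-shape Wilf equivalent. Put $$\sigma''=\begin{pmatrix}0&0&\sigma\\0&1&0\\ \sigma^t&0&0\end{pmatrix},\qquad \tau''=\begin{pmatrix}0&0&\tau\\0&1&0\\ \tau^t&0&0\end{pmatrix},$$ where $^t$ denotes the transpose and the central block is the $1\times 1$ matrix $(1)$. Then $\sigma''$ and $\tau''$ are I-Wilf equivalent, i.e. $|SI_n(\sigma'')|=|SI_n(\tau'')|$ for every $n\ge 1$. Moreover, for every $n\ge1$ there is a bijection $SI_n(\sigma'')\to SI_n(\tau'')$ which preserves fixed points.
   Context: A signed permutation matrix of size $n$ is an $n\times n$ matrix with entries in $\{0,1,-1\}$ having exactly one nonzero entry in every row and every column; $B_n$ denotes the set of these. $SI_n$ is the set of involutions in $B_n$, i.e. the symmetric signed permutation matrices of size $n$. A matrix $p\in B_n$ corresponds to the word $\pi=\pi_1\cdots\pi_n$ with $\pi_i=j$ if $p_{ij}=1$ and $\pi_i=-j$ if $p_{ij}=-1$; the two are identified. An index $i$ is a fixed point of a signed involution $\pi$ if $|\pi_i|=i$. An element $\pi\in B_n$ contains $\tau\in B_k$ if the matrix $\tau$ is a submatrix of the matrix $\pi$ (rows and columns kept in order); otherwise $\pi$ avoids $\tau$. For a set $M$ of signed permutations, $M(\tau)$ is the set of elements of $M$ avoiding $\tau$. A Young shape (Young diagram) is a top-justified and left-justified array of cells whose rows have non-increasing lengths from top to bottom (so its columns have non-increasing lengths from left to right). An NE-shape is a top-right justified array of cells, i.e. the mirror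 image of a Young shape under left-right reflection. A signed transversal of a shape $\lambda$ is an assignment of $0$'s, $1$'s and $-1$'s to the cells of $\lambda$ such that each row and each column contains exactly one nonzero entry. A filling of $\lambda$ contains a $k\times k$ signed permutation matrix $\tau$ if there are $k$ rows and $k$ columns of $\lambda$ such that all $k^2$ cells in their intersection belong to $\lambda$ and the induced filling of these cells equals $\tau$; otherwise it avoids $\tau$. $B_\lambda(\tau)$ is the set of signed transversals of $\lambda$ avoiding $\tau$. Two signed permutation matrices $\sigma,\tau$ are NE-shape Wilf equivalent if $|B_\lambda(\sigma)|=|B_\lambda(\tau)|$ for every NE-shape $\lambda$. *)

(* Defs.v *)
From HB Require Import structures.
From mathcomp Require Import all_boot all_order all_algebra.
From mathcomp Require Import classical_sets functions cardinality.

Set Implicit Arguments.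
Unset Strict Implicit.
Unset Printing Implicit Defensive.

Local Open Scope classical_set_scope.
Local Open Scope card_scope.
Local Open Scope ring_scope.
Import GRing.Theory.

Definition one_nonzero_per_line m n (A : 'M[int]_(m, n)) : Prop :=
  (forall i, exists! j, A i j != 0) /\ (forall j, exists! i, A i j != 0).

Definition signed_entries m n (A : 'M[int]_(m, n)) : Prop :=
  forall i j, A i j \in [:: 0; 1; -1].

Definition signed_perm_mx n (A : 'M[int]_n) : Prop :=
  signed_entries A /\ one_nonzero_per_line A.

Definition signed_invol n : set 'M[int]_n :=
  [set A | signed_perm_mx A /\ A^T = A].

(* The letter pi_i of the word of A, with values in {+-1, ..., +-n}: row and
   column indices start at 0, and the only nonzero summand is +-(j + 1). *)
Definition letter n (A : 'M[int]_n) (i : 'I_n) : int :=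
  \sum_(j < n) A i j * (j.+1)%:Z.

Definition fixed_point n (A : 'M[int]_n) (i : 'I_n) : Prop :=
  `|letter A i|%N = i.+1.

Definition increasing m n (f : 'I_m -> 'I_n) : Prop :=
  {homo f : i j / (i < j)%N}.

Definition mx_contains n k (A : 'M[int]_n) (t : 'M[int]_k) : Prop :=
  exists f g : 'I_k -> 'I_n,
    [/\ increasing f, increasing g & mxsub f g A = t].

Definition SI n k (t : 'M[int]_k) : set 'M[int]_n :=
  [set A | signed_invol A /\ ~ mx_contains A t].
Arguments SI n {k} t _.

(* A shape is given by its set D of cells (row, column), rows being numbered
   from top to bottom and columns from left to right.  It is top-right justified
   when D is closed under moving up and to the right; the first two conditions
   say that m and n are the actual numbers of rows and columns of the shape. *)
Definition NE_shape m n (D : {set 'I_m * 'I_n}) : Prop :=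
  [/\ forall i, exists j, (i, j) \in D,
      forall j, exists i, (i, j) \in D
    & forall (i i' : 'I_m) (j j' : 'I_n), (i' <= i)%N -> (j <= j')%N ->
        (i, j) \in D -> (i', j') \in D].

(* A filling of D is encoded as a matrix that vanishes outside D. *)
Definition signed_transversal m n (D : {set 'I_m * 'I_n}) : set 'M[int]_(m, n) :=
  [set A | [/\ signed_entries A,
               forall i j, (i, j) \notin D -> A i j = 0
             & one_nonzero_per_line A]].

Definition filling_contains m n (D : {set 'I_m * 'I_n}) (A : 'M[int]_(m, n))
    k (t : 'M[int]_k) : Prop :=
  exists (f : 'I_k -> 'I_m) (g : 'I_k -> 'I_n),
    [/\ increasing f, increasing g,
        forall i j, (f i, g j) \in D & mxsub f g A = t].

Definition B_shape m n (D : {set 'I_m * 'I_n}) k (t : 'M[int]_k) :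
    set 'M[int]_(m, n) :=
  [set A | signed_transversal D A /\ ~ filling_contains D A t].

(* [A #= B] is equality of cardinals; all the sets compared here are finite. *)
Definition NE_shape_Wilf k l (s : 'M[int]_k) (t : 'M[int]_l) : Prop :=
  forall m n (D : {set 'I_m * 'I_n}), NE_shape D -> B_shape D s #= B_shape D t.

Definition I_Wilf k l (s : 'M[int]_k) (t : 'M[int]_l) : Prop :=
  forall n, (0 < n)%N -> SI n s #= SI n t.

(*  0  0  s
    0  1  0
   s^T 0  0  *)
Definition antidiag_ext k (s : 'M[int]_k) : 'M[int]_(k + (1 + k)) :=
  block_mx 0            (row_mx 0 s)
           (col_mx 0 s^T) (block_mx 1%:M 0 0 0).

(* Main.v *)
Require Import Defs.
From HB Require Import structures.
From mathcomp Require Import all_boot all_order all_algebra.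
From mathcomp Require Import classical_sets functions cardinality boolp.
From mathcomp Require Import zify.

(** Read in a symmetric matrix [A], an occurrence of the big pattern is a central
    entry 1 at a cell [(r, c)] together with a copy of [sigma] strictly above and
    strictly to the right of it and a copy of [sigma^T] strictly below and to the
    left.  By symmetry of [A] one may take [r <= c], and then the copy of
    [sigma^T] is just the mirror image of the copy of [sigma].  So let [corner A]
    be the set of all cells strictly north-east of some entry 1 located on or
    above the diagonal.  It is closed under moving up and right, and
    [contains_antidiag_ext] says that [A] contains the big pattern exactly when
    [sigma] occurs in the filling of [corner A] (all cells of the occurrence lie
    in [corner A] as soon as its south-west one does, which is where [k > 0] is
    used).

    One can therefore exchange the filling of [corner A], simultaneously with
    its mirror image below the diagonal, for a [tau]-avoiding one having the
    same nonempty rows and columns.  Three things make this a bijection.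
    - The region does not move ([corner_glue]): it is already generated by the
      1s that lie outside it, since a 1 inside it only generates cells that
      another 1 generates as well ([corner_minimal]).
    - The result is again a signed involution ([glue_invol]): the number of
      nonzero entries in a line is the sum of the contributions of the region,
      of its mirror image, and of the untouched cells.
    - Once the empty rows and columns are deleted, the filling of the region is
      a signed transversal of an NE-shape, so the hypothesis supplies a
      bijection ([avoiders_card_eq]).
    The region lies strictly above the diagonal, so the diagonal entries, and
    with them the fixed points, stay what they were.

    When [sigma] is empty the hypothesis forces [tau] to be empty too
    ([NE_shape_Wilf_size0]), and the identity map works. *)

Set Implicit Arguments.
Unset Strict Implicit.
Unset Printing Implicit Defensive.

Local Open Scope card_scope.
Local Open Scope ring_scope.
Import GRing.Theory.

(** * Bijections, unique existence and increasing maps *)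

Lemma card_eq_set_bij T (U : choiceType) (A : set T) (B : set U) (u : U) :
  A #= B <-> exists f : T -> U, set_bij A B f.
Proof.
pose U' : pointedType := HB.pack U (isPointed.Build U u).
by split=> [|h]; apply/(@card_set_bijP T U' A B).
Qed.

Lemma exists_uniqueP (T : finType) (P : pred T) :
  (exists! x, P x) <-> (\sum_x P x = 1)%N.
Proof.
split=> [[x [Px xP]]|/eqP/sum_nat_eq1[x [_ Px Pnx]]].
  rewrite (bigD1 x) //= Px big1 // => y yx.
  by apply/eqP; rewrite eqb0; apply: contra yx => /xP ->.
exists x; split=> [|y Py]; first by move: Px; case: (P x).
by apply/eqP; rewrite eq_sym; apply: contraT => /Pnx/(_ isT); rewrite Py.
Qed.

Lemma exists_increasing_enum n (R : {set 'I_n}) :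
  exists m (f : 'I_m -> 'I_n), increasing f /\ R = f @: [set: 'I_m].
Proof.
have mono : {mono @Order.enum_val _ 'I_n (mem R) : i j / (i <= j)%O}.
  by apply: Order.le_enum_val => x y; apply: leq_total.
exists #|R|, (@Order.enum_val _ 'I_n (mem R)); split.
  move=> i j ij; rewrite ltnNge; have := mono j i.
  by rewrite !leEord => ->; rewrite -ltnNge.
apply/setP => x; apply/idP/imsetP => [xR|[a _ ->]]; last exact: Order.enum_valP.
by exists (Order.enum_rank_in xR x); rewrite ?Order.enum_rankK_in.
Qed.

Lemma increasing_inj m n (f : 'I_m -> 'I_n) : increasing f -> injective f.
Proof.
move=> fI i j fij; apply: val_inj.
by case: (ltngtP (i : nat) j) => [/fI|/fI|//]; rewrite fij ltnn.
Qed.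

Lemma increasing_comp m n p (f : 'I_n -> 'I_p) (g : 'I_m -> 'I_n) :
  increasing f -> increasing g -> increasing (f \o g).
Proof. by move=> fI gI i j ij; apply/fI/gI. Qed.

Lemma increasing_cancel m n p (f : 'I_n -> 'I_p) (g : 'I_m -> 'I_n) :
  increasing f -> increasing (f \o g) -> increasing g.
Proof.
move=> fI fgI i j /fgI /=; case: (ltngtP (g i) (g j)) => // [/fI|/val_inj ->].
  by move=> h1 h2; have := ltn_trans h1 h2; rewrite ltnn.
by rewrite ltnn.
Qed.

Lemma increasing_le m n (f : 'I_m -> 'I_n) (i j : 'I_m) :
  increasing f -> (i <= j)%N -> (f i <= f j)%N.
Proof.
by move=> fI; rewrite leq_eqVlt => /orP[/eqP/val_inj ->//|/fI/ltnW].
Qed.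

(** * Numbers of nonzero entries in rows and columns *)

Definition row_weight m n (A : 'M[int]_(m, n)) (i : 'I_m) : nat :=
  (\sum_j (A i j != 0)%R)%N.

Definition row_support m n (A : 'M[int]_(m, n)) : {set 'I_m} :=
  [set i | row_weight A i != 0%N].

(** Counting turns the unique-existence conditions into equations between sums,
    which can be split along a partition of the cells. *)
Lemma one_nonzero_per_lineP m n (A : 'M[int]_(m, n)) :
  one_nonzero_per_line A <->
  (forall i, row_weight A i = 1%N) /\ (forall j, row_weight A^T j = 1%N).
Proof.
have colE j : row_weight A^T j = (\sum_i (A i j != 0)%R)%N.
  by apply: eq_bigr => i _; rewrite mxE.
split=> -[rA cA]; split=> i; rewrite ?colE.
- exact/(exists_uniqueP (fun j => A i j != 0)).
- exact/(exists_uniqueP (fun j => A j i != 0)).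
- exact/(exists_uniqueP (fun j => A i j != 0))/rA.
- by apply/(exists_uniqueP (fun j => A j i != 0)); rewrite -colE cA.
Qed.

Lemma row_weight_gt0 m n (A : 'M[int]_(m, n)) i j :
  A i j != 0 -> (0 < row_weight A i)%N.
Proof. by move=> Aij; rewrite /row_weight (bigD1 j) //= Aij. Qed.

Lemma row_weight_neq0 m n (A : 'M[int]_(m, n)) i :
  row_weight A i != 0%N -> exists j, A i j != 0.
Proof.
rewrite sum_nat_eq0 => /forallPn[j]; rewrite /= eqb0 negbK => Aij.
by exists j.
Qed.

Lemma row_unique m n (A : 'M[int]_(m, n)) i j j' :
  one_nonzero_per_line A -> A i j != 0 -> A i j' != 0 -> j = j'.
Proof. by move=> [/(_ i) [j0 [_ u]] _] /u <- /u <-. Qed.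

Lemma col_unique m n (A : 'M[int]_(m, n)) i i' j :
  one_nonzero_per_line A -> A i j != 0 -> A i' j != 0 -> i = i'.
Proof. by move=> [_ /(_ j) [j0 [_ u]]] /u <- /u <-. Qed.

(** * Fillings with prescribed nonempty rows and columns *)

Definition NE_closed m n (D : {set 'I_m * 'I_n}) : Prop :=
  forall (i i' : 'I_m) (j j' : 'I_n), (i' <= i)%N -> (j <= j')%N ->
    (i, j) \in D -> (i', j') \in D.

(** What the transversals of a shape become when empty rows and columns are
    allowed: [R] and [C] are the rows and columns that are not empty. *)
Definition partial_transversal m n (D : {set 'I_m * 'I_n}) (R : {set 'I_m})
    (C : {set 'I_n}) : set 'M[int]_(m, n) :=
  [set F | [/\ signed_entries F,
               forall i j, (i, j) \notin D -> F i j = 0,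
               forall i, row_weight F i = (i \in R)
             & forall j, row_weight F^T j = (j \in C)]]%classic.

Definition avoiders m n (D : {set 'I_m * 'I_n}) (R : {set 'I_m})
    (C : {set 'I_n}) k (s : 'M[int]_k) : set 'M[int]_(m, n) :=
  [set F | partial_transversal D R C F /\ ~ filling_contains D F s]%classic.

Lemma partial_transversal_supp m n (D : {set 'I_m * 'I_n}) R C F i j :
  partial_transversal D R C F -> F i j != 0 -> i \in R /\ j \in C.
Proof.
move=> [_ _ rF cF] Fij; split.
  by have := row_weight_gt0 Fij; rewrite rF lt0b.
have /row_weight_gt0 : F^T j i != 0 by rewrite mxE.
by rewrite cF lt0b.
Qed.

(** Deleting the empty rows and columns.  The surviving ones are the images of
    the increasing maps [r] and [c], so that deletion is [mxsub r c]. *)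
Section Compression.
Variables (m n p q : nat) (D : {set 'I_m * 'I_n}).
Variables (r : 'I_p -> 'I_m) (c : 'I_q -> 'I_n).
Hypotheses (rI : increasing r) (cI : increasing c).
Let R := r @: [set: 'I_p].
Let C := c @: [set: 'I_q].

Definition compressed_shape : {set 'I_p * 'I_q} :=
  [set x | (r x.1, c x.2) \in D].

Lemma row_weight_mxsub m' n' p' q' (f : 'I_p' -> 'I_m') (g : 'I_q' -> 'I_n')
    (F : 'M[int]_(m', n')) a :
  injective g -> (forall j, F (f a) j != 0 -> j \in g @: [set: 'I_q']) ->
  row_weight (mxsub f g F) a = row_weight F (f a).
Proof.
move=> gI suppF; rewrite /row_weight (bigID (mem (g @: [set: 'I_q']))) /=.
rewrite [X in (_ = _ + X)%N]big1 ?addn0 => [|j jC]; last first.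
  by apply/eqP; rewrite eqb0; apply: contra jC; apply: suppF.
rewrite big_imset /=; last by move=> ? ? _ _; apply: gI.
by apply: eq_big => b; rewrite ?inE ?mxE.
Qed.

Lemma mxsub_row_weight (F : 'M[int]_(m, n)) :
  (forall i j, F i j != 0 -> i \in R /\ j \in C) ->
  (forall a, row_weight (mxsub r c F) a = row_weight F (r a)) /\
  (forall b, row_weight (mxsub r c F)^T b = row_weight F^T (c b)).
Proof.
move=> suppF; split=> [a|b].
  by apply: row_weight_mxsub => [|j /suppF[]//]; apply: increasing_inj.
rewrite trmx_mxsub; apply: row_weight_mxsub => [|j]; first exact: increasing_inj.
by rewrite mxE => /suppF[].
Qed.

(** Each row and each column of [s] has a nonzero entry, so an occurrence of [s]
    can only use rows and columns that survive the deletion. *)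
Lemma filling_contains_mxsub (F : 'M[int]_(m, n)) k (s : 'M[int]_k) :
  one_nonzero_per_line s -> (forall i j, F i j != 0 -> i \in R /\ j \in C) ->
  filling_contains compressed_shape (mxsub r c F) s <-> filling_contains D F s.
Proof.
move=> [rs cs] suppF; split=> [[f [g [fI gI fgD fgs]]]|[f [g [fI gI fgD fgs]]]].
  exists (r \o f), (c \o g); split; try exact: increasing_comp.
    by move=> i j; have := fgD i j; rewrite inE.
  by rewrite -fgs; apply/matrixP => i j; rewrite !mxE.
have /fin_all_exists[f' f'E] (x : 'I_k) : exists a, f x = r a.
  have [y [sxy _]] := rs x; have : F (f x) (g y) != 0.
    by move: sxy; rewrite -fgs mxE.
  by move=> /suppF[/imsetP[a _ ->]]; exists a.
have /fin_all_exists[g' g'E] (y : 'I_k) : exists b, g y = c b.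
  have [x [sxy _]] := cs y; have : F (f x) (g y) != 0.
    by move: sxy; rewrite -fgs mxE.
  by move=> /suppF[_ /imsetP[a _ ->]]; exists a.
exists f', g'; split.
- by apply: increasing_cancel rI _ => i j /fI; rewrite !f'E.
- by apply: increasing_cancel cI _ => i j /gI; rewrite !g'E.
- by move=> i j; rewrite inE /= -f'E -g'E.
- by rewrite -fgs; apply/matrixP => i j; rewrite !mxE -f'E -g'E.
Qed.

Definition expand (M : 'M[int]_(p, q)) : 'M[int]_(m, n) :=
  \matrix_(i, j)
    if [pick x : 'I_p * 'I_q | (r x.1 == i) && (c x.2 == j)] is Some x
    then M x.1 x.2 else 0.

Lemma mxsub_expand M : mxsub r c (expand M) = M.
Proof.
apply/matrixP => a b; rewrite !mxE; case: pickP => [[a' b'] /=|].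
  by move=> /andP[/eqP/(increasing_inj rI)-> /eqP/(increasing_inj cI)->].
by move=> /(_ (a, b)); rewrite /= !eqxx.
Qed.

Lemma expand_supp M i j : expand M i j != 0 -> i \in R /\ j \in C.
Proof.
rewrite mxE; case: pickP => [[a b] /= /andP[/eqP<- /eqP<-] _|]; last by rewrite eqxx.
by split; apply: imset_f.
Qed.

Lemma mxsub_supported_inj (F G : 'M[int]_(m, n)) :
  (forall i j, F i j != 0 -> i \in R /\ j \in C) ->
  (forall i j, G i j != 0 -> i \in R /\ j \in C) ->
  mxsub r c F = mxsub r c G -> F = G.
Proof.
move=> suppF suppG FG; apply/matrixP => i j.
have [[/imsetP[a _ ->] /imsetP[b _ ->]]|out] := pselect (i \in R /\ j \in C).
  by have /matrixP/(_ a b) := FG; rewrite !mxE.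
have -> : F i j = 0 by apply/eqP; apply: contra_notT out; apply: suppF.
by apply/esym/eqP; apply: contra_notT out; apply: suppG.
Qed.

Lemma partial_transversal_mxsub (F : 'M[int]_(m, n)) :
  (forall i j, F i j != 0 -> i \in R /\ j \in C) ->
  signed_transversal compressed_shape (mxsub r c F) <->
  partial_transversal D R C F.
Proof.
move=> suppF; have [rF cF] := mxsub_row_weight suppF.
have F0 i j : ~ (i \in R /\ j \in C) -> F i j = 0.
  by move=> out; apply/eqP; apply: contra_notT out; apply: suppF.
split=> [[sF DF /one_nonzero_per_lineP[r1 c1]]|[sF DF r1 c1]].
  split=> [i j|i j ijD|i|j].
  - have [[/imsetP[a _ ->] /imsetP[b _ ->]]|out] := pselect (i \in R /\ j \in C).
      by have := sF a b; rewrite mxE.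
    by rewrite F0.
  - have [[/imsetP[a _ ia] /imsetP[b _ jb]]|out] := pselect (i \in R /\ j \in C).
      by have := DF a b; rewrite mxE inE /= -ia -jb; apply.
    by rewrite F0.
  - have [/imsetP[a _ ->]|iR] := boolP (i \in R); first by rewrite -rF r1.
    by apply/eqP; apply: contraNT iR => /row_weight_neq0[j /suppF[]].
  - have [/imsetP[b _ ->]|jC] := boolP (j \in C); first by rewrite -cF c1.
    by apply/eqP; apply: contraNT jC => /row_weight_neq0[i]; rewrite mxE => /suppF[].
split=> [a b|a b|]; first by rewrite mxE.
  by rewrite inE mxE; apply: DF.
apply/one_nonzero_per_lineP; split=> [a|b].
  by rewrite rF r1 imset_f.
by rewrite cF c1 imset_f.
Qed.

Lemma avoiders_compress k (s : 'M[int]_k) : one_nonzero_per_line s ->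
  avoiders D R C s #= B_shape compressed_shape s.
Proof.
move=> s1; apply/(card_eq_set_bij _ _ 0); exists (mxsub r c); split.
- move=> F [FT Fs]; have suppF i j := @partial_transversal_supp _ _ _ _ _ F i j FT.
  split; first exact/partial_transversal_mxsub.
  by move=> /(filling_contains_mxsub s1 suppF).
- move=> F G /set_mem[FT _] /set_mem[GT _].
  by apply: mxsub_supported_inj => i j; apply: partial_transversal_supp; eassumption.
- move=> M [MT Ms]; exists (expand M); last exact: mxsub_expand.
  split.
    apply/partial_transversal_mxsub; rewrite ?mxsub_expand //.
    exact: expand_supp.
  by move=> /(filling_contains_mxsub s1 (@expand_supp M)); rewrite mxsub_expand.
Qed.

Lemma NE_shape_compressed F : NE_closed D -> partial_transversal D R C F ->
  NE_shape compressed_shape.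
Proof.
move=> clD FT; have suppF i j := @partial_transversal_supp _ _ _ _ _ F i j FT.
have /(partial_transversal_mxsub suppF)[_ DF [r1 c1]] := FT.
split=> [a|b|a a' b b' aa bb].
- have [b [Fab _]] := r1 a; exists b; apply: contraT => /DF Fab0.
  by rewrite Fab0 eqxx in Fab.
- have [a [Fab _]] := c1 b; exists a; apply: contraT => /DF Fab0.
  by rewrite Fab0 eqxx in Fab.
- by rewrite !inE /=; apply: clD; apply: increasing_le.
Qed.

End Compression.

(** If there is some filling with nonempty lines [R] and [C], deleting the other
    lines leaves a genuine NE-shape, to which the hypothesis applies; otherwise
    both sets are empty. *)
Lemma avoiders_card_eq m n (D : {set 'I_m * 'I_n}) R C
    k l (s : 'M[int]_k) (t : 'M[int]_l) :
  one_nonzero_per_line s -> one_nonzero_per_line t -> NE_shape_Wilf s t ->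
  NE_closed D -> avoiders D R C s #= avoiders D R C t.
Proof.
move=> s1 t1 st clD.
have [p [r [rI ->]]] := exists_increasing_enum R.
have [q [c [cI ->]]] := exists_increasing_enum C.
have [[F FT]|noF] := pselect (exists F,
    partial_transversal D (r @: [set: 'I_p]) (c @: [set: 'I_q]) F).
  apply: card_eq_trans (avoiders_compress D rI cI s1) _.
  apply: card_eq_trans (card_esym (avoiders_compress D rI cI t1)).
  by apply: st; apply: NE_shape_compressed FT.
have empty k' (u : 'M[int]_k') :
    avoiders D (r @: [set: 'I_p]) (c @: [set: 'I_q]) u = set0.
  by apply/seteqP; split=> // F [FT _]; apply: noF; exists F.
by rewrite !empty; apply: card_eqxx.
Qed.

(** * The region above and to the right of the upper 1s *)

Definition corner n (A : 'M[int]_n) : {set 'I_n * 'I_n} :=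
  [set x : 'I_n * 'I_n | [exists r : 'I_n, exists c : 'I_n,
     [&& (x.1 < r)%N, (r <= c)%N, (c < x.2)%N & A r c == 1]]].

Lemma cornerP n (A : 'M[int]_n) (i j : 'I_n) :
  reflect (exists r c : 'I_n, [/\ (i < r)%N, (r <= c)%N, (c < j)%N & A r c = 1])
          ((i, j) \in corner A).
Proof.
rewrite inE /=; apply: (iffP existsP) => [[r /existsP[c /and4P[? ? ? /eqP ?]]]|].
  by exists r, c.
by move=> [r [c [? ? ? /eqP ?]]]; exists r; apply/existsP; exists c; apply/and4P.
Qed.

Lemma corner_NE_closed n (A : 'M[int]_n) : NE_closed (corner A).
Proof.
move=> i i' j j' ii jj /cornerP[r [c [ir rc cj Arc]]]; apply/cornerP.
by exists r, c; split=> //; [apply: leq_ltn_trans ir|apply: leq_trans jj].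
Qed.

Lemma corner_upper n (A : 'M[int]_n) (i j : 'I_n) : (i, j) \in corner A -> (i < j)%N.
Proof.
case/cornerP=> r [c [ir rc cj _]]; apply: leq_ltn_trans cj.
exact: ltnW (leq_trans ir rc).
Qed.

(** Descent on [c - r]: a 1 inside the region has another 1 strictly to its
    south-west, still on or above the diagonal. *)
Lemma corner_minimal n (A : 'M[int]_n) (r c : 'I_n) : (r <= c)%N -> A r c = 1 ->
  exists r' c' : 'I_n,
    [/\ (r <= r' <= c')%N, (c' <= c)%N, A r' c' = 1 & (r', c') \notin corner A].
Proof.
have [d] := ubnP (c - r)%N; elim: d r c => // d IH r c dcr rc Arc.
have [/cornerP[r' [c' [h1 h2 h3 A']]]|out] := boolP ((r, c) \in corner A).
  have [|//|//|r2 [c2 [/andP[h4 h5] h6 ? ?]]] := IH r' c'; first by lia.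
  by exists r2, c2; split=> //; lia.
by exists r, c; split=> //; rewrite leqnn.
Qed.

(** A 1 of [B] inside [corner A] generates only cells of [corner A], and by
    [corner_minimal] the 1s of [A] outside [corner A], which [B] shares, already
    generate all of it. *)
Lemma corner_eq n (A B : 'M[int]_n) :
  (forall i j : 'I_n, (i <= j)%N -> (i, j) \notin corner A -> B i j = A i j) ->
  corner B = corner A.
Proof.
move=> AB; apply/setP => -[i j]; apply/cornerP/idP => [[r [c [h1 h2 h3 Brc]]]|].
  have [rcD|rcD] := boolP ((r, c) \in corner A).
    by apply: corner_NE_closed rcD; apply: ltnW.
  by apply/cornerP; exists r, c; split=> //; rewrite -AB.
move=> /cornerP[r [c [h1 h2 h3 Arc]]].
have [r' [c' [/andP[h4 h5] h6 A' out]]] := corner_minimal h2 Arc.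
by exists r', c'; split; rewrite ?AB //; lia.
Qed.

(** * Occurrences of the extended pattern *)

(** The row and column maps of an occurrence, along the three blocks of indices. *)
Definition splice k n (f g : 'I_k -> 'I_n) (x : 'I_n) (z : 'I_(k + (1 + k))) : 'I_n :=
  match fintype.split z with
  | inl a => f a
  | inr z' => match fintype.split z' with inl _ => x | inr b => g b end
  end.

Section Splice.
Variables (k n : nat) (f g : 'I_k -> 'I_n) (x : 'I_n).

Lemma splice_lo a : splice f g x (lshift (1 + k) a) = f a.
Proof. by rewrite /splice -[lshift _ a]/(unsplit (inl a)) unsplitK. Qed.

Lemma splice_mid (o : 'I_1) : splice f g x (rshift k (lshift k o)) = x.
Proof.
rewrite /splice -[rshift k _]/(unsplit (inr _)) unsplitK.
by rewrite -[lshift k o]/(unsplit (inl o)) unsplitK.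
Qed.

Lemma splice_hi b : splice f g x (rshift k (rshift 1 b)) = g b.
Proof.
rewrite /splice -[rshift k _]/(unsplit (inr _)) unsplitK.
by rewrite -[rshift 1 b]/(unsplit (inr b)) unsplitK.
Qed.

Lemma splice_increasing : increasing f -> increasing g ->
  (forall a, (f a < x)%N) -> (forall b, (x < g b)%N) -> increasing (splice f g x).
Proof.
move=> fI gI fx xg y z.
have fg a b : (f a < g b)%N by apply: ltn_trans (xg b).
case: (split_ordP y) => [a ->|y' ->]; last case: (split_ordP y') => [o ->|b ->];
(case: (split_ordP z) => [a' ->|z' ->]; last case: (split_ordP z') => [o' ->|b' ->]);
rewrite ?splice_lo ?splice_mid ?splice_hi //=.
- exact: fI.
- by have := ltn_ord a'; lia.
- by rewrite !ord1 ltnn.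
- by have := ltn_ord a'; lia.
- by have := ltn_ord o'; lia.
- by rewrite !ltn_add2l; apply: gI.
Qed.

End Splice.

(** Left to right, when the central 1 lies below the diagonal the roles of rows
    and columns are exchanged, and it is the copy of [s^T] that is reflected.
    Right to left, only the two copies of [s] and the central 1 have to be found:
    they account for the nonzero entry in each of the rows and columns that are
    used, so the remaining blocks vanish. *)
Lemma contains_antidiag_ext n (A : 'M[int]_n) k (s : 'M[int]_k) :
  (0 < k)%N -> one_nonzero_per_line s -> signed_invol A ->
  mx_contains A (antidiag_ext s) <-> filling_contains (corner A) A s.
Proof.
move=> k0 [rs cs] [[_ A1] At].
have sA i j : A i j = A j i by rewrite -[in LHS]At mxE.
split=> [[f [g [fI gI /matrixP fgs]]]|[f [g [fI gI fgD fgs]]]].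
  pose lo (x : 'I_k) : 'I_(k + (1 + k)) := lshift (1 + k) x.
  pose mid : 'I_(k + (1 + k)) := rshift k (lshift k ord0).
  pose hi (x : 'I_k) : 'I_(k + (1 + k)) := rshift k (rshift 1 x).
  have lom x : (lo x < mid)%N by rewrite /= addn0.
  have mhi x : (mid < hi x)%N by rewrite /= addn0; lia.
  have loI : increasing lo by [].
  have hiI : increasing hi by move=> i j ij; rewrite /= !ltn_add2l.
  have Amid : A (f mid) (g mid) = 1.
    have := fgs mid mid; rewrite mxE => ->.
    by rewrite block_mxEdr block_mxEul mxE.
  have Ahi i j : A (f (lo i)) (g (hi j)) = s i j.
    have := fgs (lo i) (hi j); rewrite mxE => ->.
    by rewrite block_mxEur row_mxEr.
  have Alo i j : A (f (hi i)) (g (lo j)) = s j i.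
    have := fgs (hi i) (lo j); rewrite mxE => ->.
    by rewrite block_mxEdl col_mxEd mxE.
  have [rc|cr] := leqP (f mid) (g mid).
    exists (f \o lo), (g \o hi); split; try exact: increasing_comp.
      move=> i j; apply/cornerP; exists (f mid), (g mid).
      by split=> //; [apply: fI|apply: gI].
    by apply/matrixP => i j; rewrite mxE Ahi.
  exists (g \o lo), (f \o hi); split; try exact: increasing_comp.
    move=> i j; apply/cornerP; exists (g mid), (f mid); split=> //.
    - exact: gI.
    - exact: ltnW.
    - exact: fI.
    - by rewrite sA.
  by apply/matrixP => i j; rewrite mxE sA Alo.
(* The 1 that puts the south-west cell of the occurrence in the region works
   for all of its cells. *)
have [r [c [fr rc cg Arc]]] : exists r c : 'I_n,
    [/\ forall i, (f i < r)%N, (r <= c)%N, forall j, (c < g j)%N & A r c = 1].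
  case: k k0 s rs cs f g fI gI fgD fgs => // k _ s rs cs f g fI gI fgD fgs.
  have /cornerP[r [c [h1 h2 h3 Arc]]] := fgD ord_max ord0.
  exists r, c; split=> // [i|j].
    by apply: leq_ltn_trans h1; apply: increasing_le => //; apply: leq_ord.
  by apply: leq_trans h3 _; apply: increasing_le.
have Afg i j : A (f i) (g j) = s i j by rewrite -fgs mxE.
have rowf i j : (forall b, j != g b) -> A (f i) j = 0.
  move=> jg; apply/eqP; apply: contraT => Aij.
  have [b [sib _]] := rs i; have : A (f i) (g b) != 0 by rewrite Afg.
  by move=> /(row_unique A1 Aij) jb; have := jg b; rewrite jb eqxx.
have colg i j : (forall a, i != f a) -> A i (g j) = 0.
  move=> jg; apply/eqP; apply: contraT => Aij.
  have [a [sib _]] := cs j; have : A (f a) (g j) != 0 by rewrite Afg.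
  by move=> /(col_unique A1 Aij) jb; have := jg a; rewrite jb eqxx.
have rowr j : j != c -> A r j = 0.
  move=> jc; apply/eqP; apply: contraT => Aij.
  by rewrite (row_unique A1 Aij (_ : A r c != 0)) ?eqxx ?Arc in jc.
have colc i : i != r -> A i c = 0.
  move=> jc; apply/eqP; apply: contraT => Aij.
  by rewrite (col_unique A1 Aij (_ : A r c != 0)) ?eqxx ?Arc in jc.
have neqv (x y : 'I_n) : (x < y)%N \/ (y < x)%N -> x != y.
  by move=> h; rewrite -val_eqE /=; lia.
have fc i : (f i < c)%N by apply: leq_trans rc.
have rg j : (r < g j)%N by apply: leq_ltn_trans (cg j).
have fg i j : (f i < g j)%N by apply: ltn_trans (cg j).
exists (splice f g r), (splice f g c); split; try exact: splice_increasing.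
apply/matrixP => y z; rewrite mxE /antidiag_ext.
case: (split_ordP y) => [a ->|y' ->]; last case: (split_ordP y') => [o ->|b ->];
(case: (split_ordP z) => [a' ->|z' ->]; last case: (split_ordP z') => [o' ->|b' ->]);
rewrite ?splice_lo ?splice_mid ?splice_hi.
- by rewrite block_mxEul mxE; apply: rowf => b; apply: neqv; left.
- by rewrite block_mxEur row_mxEl mxE; apply: rowf => b; apply: neqv; left.
- by rewrite block_mxEur row_mxEr Afg.
- by rewrite block_mxEdl col_mxEu mxE; apply: rowr; apply: neqv; left.
- by rewrite block_mxEdr block_mxEul !ord1 mxE.
- by rewrite block_mxEdr block_mxEur mxE; apply: colg => i; apply: neqv; right.
- by rewrite block_mxEdl col_mxEd mxE sA Afg.
- by rewrite block_mxEdr block_mxEdl mxE; apply: colc; apply: neqv; right.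
- by rewrite block_mxEdr block_mxEdr mxE; apply: colg => i; apply: neqv; right.
Qed.

(** * Exchanging the filling of the region *)

Definition restrict m n (D : {set 'I_m * 'I_n}) (A : 'M[int]_(m, n)) : 'M[int]_(m, n) :=
  \matrix_(i, j) if (i, j) \in D then A i j else 0.

Definition glue n (D : {set 'I_n * 'I_n}) (A F : 'M[int]_n) : 'M[int]_n :=
  \matrix_(i, j) if (i, j) \in D then F i j
                 else if (j, i) \in D then F j i else A i j.

(** The data preserved by the exchange; the bijection supplied by the hypothesis
    is chosen as a function of them, which makes the exchange invertible. *)
Definition signature n (A : 'M[int]_n) :=
  (corner A, row_support (restrict (corner A) A),
   row_support (restrict (corner A) A)^T).

Lemma filling_contains_restrict m n (D : {set 'I_m * 'I_n}) A k (s : 'M[int]_k) :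
  filling_contains D (restrict D A) s <-> filling_contains D A s.
Proof.
by split=> -[f [g [fI gI fgD <-]]]; exists f, g; split=> //;
  apply/matrixP => i j; rewrite !mxE fgD.
Qed.

Lemma row_support_partial m n (D : {set 'I_m * 'I_n}) R C F :
  partial_transversal D R C F -> row_support F = R /\ row_support F^T = C.
Proof.
move=> [_ _ rF cF]; split; apply/setP => i; rewrite inE ?rF ?cF; by case: (_ \in _).
Qed.

Lemma restrict_partial m n (D : {set 'I_m * 'I_n}) (A : 'M[int]_(m, n)) :
  signed_entries A -> one_nonzero_per_line A ->
  partial_transversal D (row_support (restrict D A))
    (row_support (restrict D A)^T) (restrict D A).
Proof.
move=> sA /one_nonzero_per_lineP[rA cA]; split=> [i j|i j ijD|i|j].
- by rewrite mxE; case: ifP.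
- by rewrite mxE (negbTE ijD).
- rewrite inE; have : (row_weight (restrict D A) i <= 1)%N.
    rewrite -(rA i); apply: leq_sum => j _; rewrite mxE.
    by case: ifP => // _; rewrite eqxx.
  by case: row_weight => [|[]].
- rewrite inE; have : (row_weight (restrict D A)^T j <= 1)%N.
    rewrite -(cA j); apply: leq_sum => i _; rewrite !mxE.
    by case: ifP => // _; rewrite eqxx.
  by case: row_weight => [|[]].
Qed.

Section Glue.
Variables (n : nat) (D : {set 'I_n * 'I_n}).
Hypothesis upD : forall i j : 'I_n, (i, j) \in D -> (i < j)%N.

Lemma upper_asym i j : (i, j) \in D -> (j, i) \in D = false.
Proof. by move=> /upD ij; apply: contraTF ij => /upD ji; rewrite -leqNgt ltnW. Qed.

(** No cell of [D] is the mirror image of another one, so the three kinds of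
    cells contribute separately; the last term does not depend on [F]. *)
Lemma glue_row_weight (A F : 'M[int]_n) i :
  (forall i j, (i, j) \notin D -> F i j = 0) ->
  row_weight (glue D A F) i =
  (row_weight F i + row_weight F^T i + row_weight (glue D A 0) i)%N.
Proof.
move=> F0; rewrite /row_weight -!big_split /=; apply: eq_bigr => j _; rewrite !mxE.
case: ifPn => ijD.
  have F0ji : F j i = 0 by apply: F0; rewrite upper_asym.
  by rewrite F0ji !addn0.
rewrite (F0 i j ijD); case: ifPn => [_|jiD]; first by rewrite addn0.
by rewrite (F0 j i jiD).
Qed.

Lemma glue_restrict (A : 'M[int]_n) : A^T = A -> glue D A (restrict D A) = A.
Proof.
move=> At; apply/matrixP => i j; rewrite !mxE.
have [//|_] := boolP ((i, j) \in D); have [_|//] := boolP ((j, i) \in D).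
by rewrite -[in RHS]At mxE.
Qed.

Lemma glue_glue (A F G : 'M[int]_n) : glue D (glue D A F) G = glue D A G.
Proof.
by apply/matrixP => i j; rewrite !mxE; case: ((i, j) \in D); case: ((j, i) \in D).
Qed.

Lemma restrict_glue (A F : 'M[int]_n) :
  (forall i j, (i, j) \notin D -> F i j = 0) -> restrict D (glue D A F) = F.
Proof.
move=> F0; apply/matrixP => i j; rewrite !mxE.
by have [//|/F0->] := boolP ((i, j) \in D).
Qed.

(** Replacing the restriction of [A] by [F] changes none of the three terms of
    [glue_row_weight]; the columns follow by symmetry. *)
Lemma glue_invol R C (A F : 'M[int]_n) : signed_invol A ->
  partial_transversal D R C (restrict D A) -> partial_transversal D R C F ->
  signed_invol (glue D A F).
Proof.
move=> [[sA A1] At] [_ DA rA cA] [sF DF rF cF].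
have Bt : (glue D A F)^T = glue D A F.
  apply/matrixP => i j; rewrite !mxE.
  have [/upper_asym -> //|_] := boolP ((j, i) \in D).
  by case: ifP => // _; rewrite -[in RHS]At mxE.
split=> //; split; first by move=> i j; rewrite mxE; case: ifP => // _; case: ifP.
have B1 i : row_weight (glue D A F) i = 1%N.
  have /one_nonzero_per_lineP[/(_ i) rA1 _] := A1.
  by rewrite glue_row_weight // rF cF -rA -cA -glue_row_weight // glue_restrict.
by apply/one_nonzero_per_lineP; rewrite Bt.
Qed.

End Glue.

Lemma corner_glue n (A F : 'M[int]_n) : corner (glue (corner A) A F) = corner A.
Proof.
apply: corner_eq => i j ij ijD; rewrite mxE (negbTE ijD).
by case: ifPn => // /corner_upper; rewrite ltnNge ij.
Qed.

(** Stated for arbitrary [s] and [t], so that it serves both for the map and for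
    finding preimages under it. *)
Lemma exchange_corner n (A F : 'M[int]_n) k l (s : 'M[int]_k) (t : 'M[int]_l) :
  (0 < l)%N -> one_nonzero_per_line t -> SI n (antidiag_ext s) A ->
  avoiders (signature A).1.1 (signature A).1.2 (signature A).2 t F ->
  [/\ SI n (antidiag_ext t) (glue (corner A) A F),
      signature (glue (corner A) A F) = signature A
    & restrict (corner A) (glue (corner A) A F) = F].
Proof.
move=> l0 t1 [Ai _] [FT Ft]; have [[sA A1] At] := Ai.
have Bi := glue_invol (@corner_upper n A) Ai (restrict_partial (corner A) sA A1) FT.
have rB : restrict (corner A) (glue (corner A) A F) = F.
  by case: FT => _ F0 _ _; apply: restrict_glue.
split=> //.
  split=> //; rewrite contains_antidiag_ext // corner_glue.
  by move=> /filling_contains_restrict; rewrite rB.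
have [rF cF] := row_support_partial FT.
by rewrite /signature corner_glue rB rF cF.
Qed.

Lemma restrict_avoiders n (A : 'M[int]_n) k (s : 'M[int]_k) :
  (0 < k)%N -> one_nonzero_per_line s -> SI n (antidiag_ext s) A ->
  avoiders (signature A).1.1 (signature A).1.2 (signature A).2 s
    (restrict (corner A) A).
Proof.
move=> k0 s1 [Ai As]; have [[sA A1] _] := Ai.
split; first exact: restrict_partial.
by move=> /filling_contains_restrict /(contains_antidiag_ext k0 s1 Ai).
Qed.

(** * The bijection *)

Lemma SI_bijection n k l (s : 'M[int]_k) (t : 'M[int]_l) :
  (0 < k)%N -> (0 < l)%N -> one_nonzero_per_line s -> one_nonzero_per_line t ->
  NE_shape_Wilf s t ->
  exists phi : 'M[int]_n -> 'M[int]_n,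
    set_bij (SI n (antidiag_ext s)) (SI n (antidiag_ext t)) phi /\
    forall A i, phi A i i = A i i.
Proof.
move=> k0 l0 s1 t1 st.
have /choice[psi psiP] (x : {set 'I_n * 'I_n} * {set 'I_n} * {set 'I_n}) :
    exists f, NE_closed x.1.1 ->
      set_bij (avoiders x.1.1 x.1.2 x.2 s) (avoiders x.1.1 x.1.2 x.2 t) f.
  have [cl|ncl] := pselect (NE_closed x.1.1); last by exists id.
  have /(card_eq_set_bij _ _ 0)[f fP] := avoiders_card_eq x.1.2 x.2 s1 t1 st cl.
  by exists f.
have {}psiP (A : 'M[int]_n) := psiP (signature A) (@corner_NE_closed n A).
pose phi A := glue (corner A) A (psi (signature A) (restrict (corner A) A)).
have phiP A : SI n (antidiag_ext s) A ->
  [/\ SI n (antidiag_ext t) (phi A), signature (phi A) = signature A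
    & restrict (corner A) (phi A) = psi (signature A) (restrict (corner A) A)].
  move=> As; apply: (exchange_corner l0 t1 As).
  by have [h _ _] := psiP A; apply/h/restrict_avoiders.
exists phi; split; last first.
  move=> A i; rewrite mxE; have -> // : (i, i) \in corner A = false.
  by apply/negP => /corner_upper; rewrite ltnn.
split=> [A /phiP[]//|A A' /set_mem As /set_mem As' eqphi|B Bt].
  have [_ sgA rA] := phiP A As; have [_ sgA' rA'] := phiP A' As'.
  have sgAA' : signature A = signature A' by rewrite -sgA eqphi.
  have DAA' : corner A = corner A' by have [] := sgAA'.
  have resE : restrict (corner A) A = restrict (corner A') A'.
    have [_ inj _] := psiP A; apply: inj; rewrite ?inE.
    - exact: restrict_avoiders.
    - by rewrite sgAA'; apply: restrict_avoiders.
    - by rewrite -rA eqphi DAA' rA' sgAA'.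
    (* [A] is recovered from its image, its region and its filling of it. *)
have back X : SI n (antidiag_ext s) X ->
      X = glue (corner X) (phi X) (restrict (corner X) X).
    by move=> [[_ Xt] _]; rewrite glue_glue glue_restrict.
  by rewrite (back A As) (back A' As') eqphi resE DAA'.
have [_ _ surj] := psiP B.
have [F Fs psiF] := surj _ (restrict_avoiders l0 t1 Bt).
have [As sgA rA] := exchange_corner k0 s1 Bt Fs.
exists (glue (corner B) B F) => //.
rewrite /phi sgA corner_glue rA psiF glue_glue glue_restrict //.
by case: Bt => -[].
Qed.

(** The letter at [i] has absolute value [j + 1], where [j] is the column of the
    nonzero entry of row [i]. *)
Lemma fixed_pointP n (A : 'M[int]_n) i : signed_perm_mx A ->
  fixed_point A i <-> A i i != 0.
Proof.
move=> [sA [/(_ i)[j [Aij uj]] _]].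
have letterE : letter A i = A i j * (j.+1)%:Z.
  rewrite /letter (bigD1 j) //= big1 ?addr0 // => j' jj'.
  have [->|/uj jE] := eqVneq (A i j') 0; first by rewrite mul0r.
  by rewrite jE eqxx in jj'.
have abs1 : `|A i j|%N = 1%N.
  by have := sA i j; rewrite !inE (negbTE Aij) /= => /orP[]/eqP->.
rewrite /fixed_point letterE abszM abs1 mul1n absz_nat; split=> [[/val_inj ji]|/uj->//].
by rewrite -[X in A i X]ji.
Qed.

(** The shape without cells distinguishes the empty pattern, which every filling
    contains, from all the others. *)
Lemma NE_shape_Wilf_size0 l (s : 'M[int]_0) (t : 'M[int]_l) :
  NE_shape_Wilf s t -> l = 0%N.
Proof.
move=> st; have D0 : NE_shape (finset.set0 : {set 'I_0 * 'I_0}) by split=> -[].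
have := st _ _ _ D0.
have -> : B_shape (finset.set0 : {set 'I_0 * 'I_0}) s = set0.
  apply/seteqP; split=> // A [_]; apply.
  exists id, id; split=> //; first by move=> [].
  by apply/matrixP => -[].
move=> /card_esym; rewrite card_eq0 => /eqP/seteqP[h _]; case: l t st h => // l t st h.
exfalso; apply: (h (0 : 'M[int]_(0, 0))); split; last by move=> [f]; case: (f ord0).
by split=> [i j|i j|]; rewrite ?mxE //; split=> -[].
Qed.

Theorem theorem2p3 (k l : nat) (sigma : 'M[int]_k) (tau : 'M[int]_l) :
  signed_perm_mx sigma -> signed_perm_mx tau -> NE_shape_Wilf sigma tau ->
  I_Wilf (antidiag_ext sigma) (antidiag_ext tau) /\
  (forall n : nat, (0 < n)%N ->
     exists phi : 'M[int]_n -> 'M[int]_n,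
       set_bij (SI n (antidiag_ext sigma)) (SI n (antidiag_ext tau)) phi /\
       (forall p : 'M[int]_n, SI n (antidiag_ext sigma) p ->
          forall i : 'I_n, fixed_point (phi p) i <-> fixed_point p i)).
Proof.
move=> [_ s1] [_ t1] st.
have bij n : exists phi : 'M[int]_n -> 'M[int]_n,
    set_bij (SI n (antidiag_ext sigma)) (SI n (antidiag_ext tau)) phi /\
    forall A i, phi A i i = A i i.
  case: k l sigma tau s1 t1 st => [|k] [|l] sigma tau s1 t1 st.
  - have -> : sigma = tau by apply/matrixP => -[].
    by exists id; split=> //; split=> //; move=> A At; exists A.
  - by have := NE_shape_Wilf_size0 st.
  - have ts : NE_shape_Wilf tau sigma by move=> ? ? ? ?; apply/card_esym/st.
    by have := NE_shape_Wilf_size0 ts.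
  - exact: SI_bijection.
split=> n _; have [phi [phi_bij phi_diag]] := bij n.
  by apply/(card_eq_set_bij _ _ 0); exists phi.
exists phi; split=> // p ps i; have [phi_fun _ _] := phi_bij.
rewrite !fixed_pointP ?phi_diag //; first by case: ps => -[].
by case: (phi_fun p ps) => -[].
Qed.
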